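(* Let $\mathbb{T}^3=\mathbb{R}^3/(2\pi\mathbb{Z})^3$ be the flat torus and let $\Omega$ be a 2-form on $\mathbb{T}^3$ (Berry curvature, understood in the sense of distributions) whose exterior derivative is $d\Omega=2\pi\sum_n\chi_n\,\delta^3(\mathbf{k}-\mathbf{k}_n)$, where the $\mathbf{k}_n\in\mathbb{T}^3$ are finitely many points (Weyl nodes) with chiralities $\chi_n\in\{+1,-1\}$. Let $\Omega=\gamma+d\mathcal{A}+\delta\mathcal{B}$ be its Hodge decomposition into harmonic, exact and co-exact parts. For a smooth weight $W:\mathbb{T}^3\to\mathbb{R}$ define the anomaly coupling $A=\int_{\mathbb{T}^3}W\,d\Omega$. Then $A$ couples to the co-exact sector alone, that is, the harmonic and exact parts contribute zero ($\int W\,d\gamma=0$ and $\int W\,d(d\mathcal{A})=0$) and $$A=\int_{\mathbb{T}^3}W\,d(\delta\mathcal{B})=-\int_{\mathbb{T}^3}dW\wedge\delta\mathcal{B},$$ and $A$ is quantised by the node charges: $$A=\sum_n q_n\,W(\mathbf{k}_n),\qquad q_n=2\pi\chi_n.$$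
   Context: All forms may have distributional coefficients, and integrals of a distribution-valued form against a smooth form denote the distributional pairing; $\delta^3(\mathbf{k}-\mathbf{k}_n)$ in the formula for $d\Omega$ denotes the Dirac delta 3-form at $\mathbf{k}_n$, so $\int W\,\delta^3(\mathbf{k}-\mathbf{k}_n)=W(\mathbf{k}_n)$. Every distributional 2-form on $\mathbb{T}^3$ decomposes uniquely as a harmonic form $\gamma$ ($\Delta\gamma=0$, $\Delta=d\delta+\delta d$), plus an exact form $d\mathcal{A}$, plus a co-exact form $\delta\mathcal{B}$ with $\mathcal{B}$ a 3-form, where $\delta$ is the co-derivative of the flat metric. *)

(* Defs.v *)
From HB Require Import structures.
From mathcomp Require Import all_boot all_order all_algebra.
From mathcomp Require Import generic_quotient.
From mathcomp Require Import all_classical all_reals all_analysis.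

Set Implicit Arguments.
Unset Strict Implicit.
Unset Printing Implicit Defensive.

Import Order.TTheory GRing.Theory Num.Theory.
Import numFieldNormedType.Exports.

Local Open Scope classical_set_scope.
Local Open Scope ring_scope.
Local Open Scope quotient_scope.

Section Torus.
Variable R : realType.

Definition lattice_vec (z : 'I_3 -> int) : 'rV[R]_3 :=
  \row_i (2 * pi * (z i)%:~R).

Definition lattice_rel (x y : 'rV[R]_3) : bool :=
  `[< exists z : 'I_3 -> int, y = x + lattice_vec z >].

Lemma lattice_rel_refl : reflexive lattice_rel.
Proof.
move=> x; apply/asboolP; exists (fun=> 0).
by apply/rowP => i; rewrite !mxE mulr0 addr0.
Qed.

Lemma lattice_rel_sym : symmetric lattice_rel.
Proof.
suff H x y : lattice_rel x y -> lattice_rel y x.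
  by move=> x y; apply/idP/idP; apply: H.
move=> /asboolP[z ->]; apply/asboolP; exists (fun i => - z i).
by apply/rowP => i; rewrite !mxE mulrNz mulrN addrK.
Qed.

Lemma lattice_rel_trans : transitive lattice_rel.
Proof.
move=> y x w /asboolP[z ->] /asboolP[z' ->]; apply/asboolP.
exists (fun i => z i + z' i).
by apply/rowP => i; rewrite !mxE intrD (mulrDr (2 * pi)) addrA.
Qed.

Canonical lattice_equiv :=
  EquivRel lattice_rel lattice_rel_refl lattice_rel_sym lattice_rel_trans.

Definition torus := {eq_quot lattice_equiv}.
HB.instance Definition _ := Choice.on torus.
HB.instance Definition _ := EqQuotient.on torus.

Lemma pi_torusP (x y : 'rV[R]_3) :
  \pi_torus x = \pi_torus y <-> exists z, y = x + lattice_vec z.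
Proof.
split=> [/eqmodP h|h]; last by apply/eqmodP; apply/asboolP.
by have /asboolP : lattice_rel x y by exact: h.
Qed.

Definition periodic_lift (f : torus -> R) : 'rV[R]_3 -> R :=
  fun x => f (\pi_torus x).

Definition euclid_partial (i : 'I_3) (F : 'rV[R]_3 -> R) : 'rV[R]_3 -> R :=
  fun x => 'D_(delta_mx 0 i) F x.

Definition euclid_smooth (F : 'rV[R]_3 -> R) : Prop :=
  forall s : seq 'I_3,
    continuous (foldr euclid_partial F s) /\
    forall (x : 'rV[R]_3) (i : 'I_3),
      derivable (foldr euclid_partial F s) x (delta_mx 0 i).

Definition smooth : {pred torus -> R} :=
  fun f => `[< euclid_smooth (periodic_lift f) >].

Lemma foldr_partial_lin (a : R) (F G : 'rV[R]_3 -> R) (s : seq 'I_3) :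
  euclid_smooth F -> euclid_smooth G ->
  foldr euclid_partial (a *: F + G) s =
  a *: foldr euclid_partial F s + foldr euclid_partial G s.
Proof.
move=> sF sG; elim: s => [//|i s IHs] /=; rewrite IHs; apply/funext => x.
rewrite /euclid_partial deriveD; last 2 first.
- by apply: derivableZ; apply: (sF s).2.
- exact: (sG s).2.
by rewrite deriveZ //; apply: (sF s).2.
Qed.

Lemma euclid_smooth_lin (a : R) (F G : 'rV[R]_3 -> R) :
  euclid_smooth F -> euclid_smooth G -> euclid_smooth (a *: F + G).
Proof.
move=> sF sG s; rewrite foldr_partial_lin //; split => [x|x i].
  have cF := (sF s).1 x; have cG := (sG s).1 x.
  by apply: (continuousD _ cG); apply: (continuousZl_tmp (k := a) cF).
by apply: derivableD; [apply: derivableZ; apply: (sF s).2|apply: (sG s).2].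
Qed.

Lemma euclid_smooth0 : euclid_smooth 0.
Proof.
have H s : foldr euclid_partial 0 s = 0.
  elim: s => [//|i s /= ->]; apply/funext => x.
  exact: derive_cst.
move=> s; rewrite H; split; first exact: cst_continuous.
by move=> x i; exact: derivable_cst.
Qed.

Lemma smooth_submod : submod_closed smooth.
Proof.
split=> [|a f g /asboolP sf /asboolP sg]; apply/asboolP.
  exact: euclid_smooth0.
exact: (euclid_smooth_lin a sf sg).
Qed.

HB.instance Definition _ := GRing.isSubmodClosed.Build R (torus -> R) smooth
  smooth_submod.

Record smooth_fun := SmoothFun {
  smooth_val :> torus -> R ;
  smooth_valP : smooth_val \in smooth }.
HB.instance Definition _ := [isSub for smooth_val].
HB.instance Definition _ := [Choice of smooth_fun by <:].
HB.instance Definition _ := [SubChoice_isSubLmodule of smooth_fun by <:].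

(* The value does not depend on the representative: see [lift_torus_partial]. *)
Definition torus_partial (i : 'I_3) (f : torus -> R) : torus -> R :=
  fun p => euclid_partial i (periodic_lift f) (repr p).

Lemma lift_torus_partial (i : 'I_3) (f : torus -> R) :
  periodic_lift (torus_partial i f) = euclid_partial i (periodic_lift f).
Proof.
apply/funext => x; rewrite /periodic_lift /torus_partial /euclid_partial.
have /(pi_torusP x)[z ez] : \pi_torus x = \pi_torus (repr (\pi_torus x)).
  by rewrite reprK.
rewrite {}ez /derive.
set F := fun y => f (\pi_torus y).
have P y : F (y + lattice_vec z) = F y.
  by congr f; apply/esym/pi_torusP; exists z.
suff -> : (fun h : R => h^-1 *: ((F \o shift (x + lattice_vec z))
            (h *: delta_mx 0 i) - F (x + lattice_vec z))) =
          (fun h : R => h^-1 *: ((F \o shift x) (h *: delta_mx 0 i) - F x)).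
  by [].
by apply/funext => h /=; rewrite addrA !P.
Qed.

Lemma smooth_torus_partial (i : 'I_3) (f : smooth_fun) :
  torus_partial i f \in smooth.
Proof.
apply/asboolP => s; rewrite lift_torus_partial.
have -> : foldr euclid_partial (euclid_partial i (periodic_lift f)) s =
          foldr euclid_partial (periodic_lift f) (rcons s i).
  by rewrite foldr_rcons.
by have /asboolP := smooth_valP f; apply.
Qed.

Definition smooth_partial (i : 'I_3) (f : smooth_fun) : smooth_fun :=
  SmoothFun (smooth_torus_partial i f).

Definition Cnorm (N : nat) (f : smooth_fun) : \bar R :=
  ereal_sup [set y | exists (s : seq 'I_3) (p : torus),
    (size s <= N)%N /\ y = `|foldr smooth_partial f s p|%:E].

(* Continuity for the Frechet topology defined by the C^N norms. *)
Definition distributional : {pred smooth_fun -> R} :=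
  fun u => `[< scalar u /\
    exists (C : R) (N : nat), 0 <= C /\
      forall f : smooth_fun, (`|u f|%:E <= C%:E * Cnorm N f)%E >].

Lemma Cnorm_ge (N : nat) (f : smooth_fun) (s : seq 'I_3) (p : torus) :
  (size s <= N)%N -> (`|foldr smooth_partial f s p|%:E <= Cnorm N f)%E.
Proof. by move=> sN; apply: ereal_sup_ubound; exists s, p. Qed.

Lemma le_Cnorm (M N : nat) (f : smooth_fun) :
  (M <= N)%N -> (Cnorm M f <= Cnorm N f)%E.
Proof.
move=> MN; apply: ereal_sup_le => _ [s [p [sM ->]]].
by exists s, p; split=> //; apply: leq_trans MN.
Qed.

Lemma Cnorm_ge0 (N : nat) (f : smooth_fun) : (0 <= Cnorm N f)%E.
Proof.
by apply: le_trans (Cnorm_ge (s := [::]) f (\pi_torus 0) _).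
Qed.

Lemma distributional_submod : submod_closed distributional.
Proof.
split=> [|a u v /asboolP[lu [C [N [C0 Cu]]]] /asboolP[lv [D [M [D0 Dv]]]]].
  apply/asboolP; split.
    by move=> a f g; rewrite /= mulr0 addr0.
  by exists 0, 0%N; split=> // f; rewrite mul0e normr0.
apply/asboolP; split.
  move=> b f g; rewrite !fctE lu lv !scalerDr mulrDr addrACA.
  by rewrite /GRing.scale /= mulrCA.
exists (`|a| * C + D), (maxn N M); split; first by rewrite addr_ge0 ?mulr_ge0.
move=> f; rewrite EFinD ge0_muleDl ?lee_fin ?mulr_ge0 //.
apply: (@le_trans _ _ (`|a * u f|%:E + `|v f|%:E)%E).
  by rewrite -EFinD lee_fin ler_normD.
apply: leeD.
  rewrite normrM !EFinM -muleA; apply: lee_wpmul2l; rewrite ?lee_fin //.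
  apply: le_trans (Cu f) _; apply: lee_wpmul2l; rewrite ?lee_fin //.
  by apply: le_Cnorm; rewrite leq_maxl.
apply: le_trans (Dv f) _; apply: lee_wpmul2l; rewrite ?lee_fin //.
by apply: le_Cnorm; rewrite leq_maxr.
Qed.

HB.instance Definition _ := GRing.isSubmodClosed.Build R (smooth_fun -> R)
  distributional distributional_submod.

Record torus_distribution := TorusDistribution {
  distribution_val :> smooth_fun -> R ;
  torus_distributionP : distribution_val \in distributional }.
HB.instance Definition _ := [isSub for distribution_val].
HB.instance Definition _ := [Choice of torus_distribution by <:].
HB.instance Definition _ :=
  [SubChoice_isSubLmodule of torus_distribution by <:].

Lemma distributional_partial (i : 'I_3) (u : torus_distribution) :
  (fun f => - u (smooth_partial i f)) \in distributional.
Proof.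
have /asboolP[lu [C [N [C0 Cu]]]] := torus_distributionP u.
apply/asboolP; split.
  move=> a f g.
  have -> : smooth_partial i (a *: f + g) =
            a *: smooth_partial i f + smooth_partial i g.
    apply/val_inj/funext => p /=.
    have /asboolP sf := smooth_valP f; have /asboolP sg := smooth_valP g.
    by have /(congr1 (@^~ (repr p))) := foldr_partial_lin a [:: i] sf sg.
  by rewrite lu opprD mulrN.
exists C, N.+1; split=> // f; rewrite normrN.
apply: le_trans (Cu _) _; apply: lee_wpmul2l; rewrite ?lee_fin //.
apply: ge_ereal_sup => _ [s [p [sN ->]]].
by rewrite -foldr_rcons; apply: Cnorm_ge; rewrite size_rcons.
Qed.

Definition dist_partial (i : 'I_3) (u : torus_distribution)
    : torus_distribution :=
  TorusDistribution (distributional_partial i u).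

Lemma distributional_dirac (p : torus) :
  (fun f : smooth_fun => f p) \in distributional.
Proof.
apply/asboolP; split=> //; exists 1, 0%N; split=> // f; rewrite mul1e.
exact: (Cnorm_ge (s := [::]) f p (leqnn 0)).
Qed.

Definition dirac_dist (p : torus) : torus_distribution :=
  TorusDistribution (distributional_dirac p).

End Torus.

Local Close Scope classical_set_scope.
Local Open Scope set_scope.

Notation multi_index p := {I : {set 'I_3} | #|I| == p}.

(* A p-form with coefficients in V is the family of its coefficients on the
   basis (dk_I), where dk_I is the wedge of the dk_i, i in I, taken in
   increasing order. *)
Definition alt_form (V : Type) (p : nat) : Type := {ffun multi_index p -> V}.

Section Forms.
Variables (R : realType) (V : lmodType R).

HB.instance Definition _ (p : nat) :=
  GRing.Lmodule.copy (alt_form V p) {ffun multi_index p -> V}.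

Definition form_coef (p : nat) (w : alt_form V p) (I : {set 'I_3}) : V :=
  oapp w 0 (insub I).

(* For disjoint I and J, dk_I /\ dk_J = wedge_sign I J * dk_(I :|: J). *)
Definition wedge_sign (I J : {set 'I_3}) : R :=
  (-1) ^+ #|[set ij in finset.setX I J | (ij.2 < ij.1)%N]|.

Definition scalar_form (v : V) : alt_form V 0 := [ffun=> v].

(* v dk_0 /\ dk_1 /\ dk_2 *)
Definition volume_form (v : V) : alt_form V 3 := [ffun=> v].

Variable partial : 'I_3 -> V -> V.

Definition ext_d (p : nat) (w : alt_form V p) : alt_form V p.+1 :=
  [ffun J : multi_index _ => \sum_(i in val J)
    wedge_sign [set i] (val J :\ i) *: partial i (form_coef w (val J :\ i))].

Definition hodge_star (p : nat) (w : alt_form V p) : alt_form V (3 - p) :=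
  [ffun J : multi_index _ =>
    wedge_sign (~: val J) (val J) *: form_coef w (~: val J)].

(* On q-forms in dimension n the co-derivative is
   (-1)^(n * (q + 1) + 1) * d *, that is, (-1)^q * d * when n = 3. *)
Definition coderivative (p : nat) (w : alt_form V p.+1) : alt_form V p :=
  [ffun J : multi_index _ =>
    (-1) ^+ p.+1 *: form_coef (hodge_star (ext_d (hodge_star w))) (val J)].

Definition laplacian (p : nat) (w : alt_form V p.+1) : alt_form V p.+1 :=
  ext_d (coderivative w) + coderivative (ext_d w).

End Forms.

Section DistributionalForms.
Variable R : realType.

Definition sform (p : nat) := alt_form (smooth_fun R) p.
Definition dform (p : nat) := alt_form (torus_distribution R) p.

Definition smooth_d (p : nat) : sform p -> sform p.+1 :=
  ext_d (@smooth_partial R) (p := p).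
Definition dist_d (p : nat) : dform p -> dform p.+1 :=
  ext_d (@dist_partial R) (p := p).
Definition dist_coderivative (p : nat) : dform p.+1 -> dform p :=
  coderivative (@dist_partial R) (p := p).
Definition harmonic_form (p : nat) (w : dform p.+1) : Prop :=
  laplacian (@dist_partial R) w = 0.

(* The integral over the torus, oriented by dk_0 /\ dk_1 /\ dk_2, of a /\ T:
   the coefficients of T are applied to those of a. *)
Definition integral_wedge (p : nat) (a : sform p) (T : dform (3 - p)) : R :=
  \sum_(I : {set 'I_3} | #|I| == p)
    wedge_sign R I (~: I) * form_coef T (~: I) (form_coef a I).

Definition dirac_form (k : torus R) : dform 3 := volume_form (dirac_dist k).

Definition hodge_decomposition (Omega gamma : dform 2) (A : dform 1)
    (B : dform 3) : Prop :=
  harmonic_form gamma /\ Omega = gamma + dist_d A + dist_coderivative B.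

Definition anomaly_coupling (W : smooth_fun R) (Omega : dform 2) : R :=
  integral_wedge (scalar_form W) (dist_d Omega).

End DistributionalForms.

(* Main.v *)
Require Import Defs.
From mathcomp Require Import all_boot all_order all_algebra.
From mathcomp Require Import generic_quotient.
From mathcomp Require Import all_classical all_reals all_analysis.
From mathcomp Require Import ring lra.

(* Everything but the vanishing of the harmonic part is the Leibniz rule,
   d d = 0 and the definition of the Dirac form. In coefficients, a harmonic
   2-form satisfies Laplacian u = 0 for each coefficient u, so it suffices that
   u (d_i f) = 0 for every test function f. The function
   h(x) = u (f (_ + x)) is smooth, periodic and harmonic in the classical sense,
   with d_i h(x) = u (d_i f (_ + x)). For eps > 0 the function
   (d_i h)^2 + eps h^2 attains its maximum at some q, where its Laplacian
   2 |grad d_i h|^2 + 2 eps |grad h|^2 is nonpositive; hence d_i h(q) = 0, so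
   that (d_i h)^2 <= eps sup h^2 everywhere, and d_i h = 0. *)

Set Implicit Arguments.
Unset Strict Implicit.
Unset Printing Implicit Defensive.

Import Order.TTheory GRing.Theory Num.Theory.
Import numFieldNormedType.Exports.
Local Open Scope ring_scope.

(** * Partial derivatives of functions on R^3 *)

Section ClassicalCalculus.
Local Open Scope classical_set_scope.

Lemma is_derive_line (R : realType) (V : normedModType R) (F : V -> R)
    (x v : V) (t : R) : derivable F (x + t *: v) v ->
  is_derive t (1 : R) (fun s => F (x + s *: v)) ('D_v F (x + t *: v)).
Proof.
have E : (fun h : R => h^-1 *: (((fun s => F (x + s *: v)) \o shift t) (h *: 1)
            - F (x + t *: v))) =
         (fun h : R => h^-1 *: ((F \o shift (x + t *: v)) (h *: v)
            - F (x + t *: v))).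
  apply/funext => h /=; congr (_ *: (F _ - _)).
  by rewrite [h *: 1]mulr1 scalerDl addrCA.
by move=> dF; split; rewrite /derivable /derive E.
Qed.

(** The sign of [t] is left free, so the intermediate point is located only by [|c| <= |t|]; for
    negative [t] the mean value theorem is applied on [t, 0]. *)
Lemma MVT_0 (R : realType) (f df : R -> R) (t : R) :
  (forall s, is_derive s (1 : R) f (df s)) ->
  exists2 c, `|c| <= `|t| & f t - f 0 = t * df c.
Proof.
move=> fd.
have cf (A : set R) : {within A, continuous f}.
  apply: continuous_subspaceT => r.
  by apply/differentiable_continuous/derivable1_diffP; case: (fd r).
have [t0|t0] := leP 0 t.
  have [c /[!in_itv]/= /andP[c0 ct] ->] :=
    MVT_segment t0 (fun s _ => fd s) (cf _).
  by exists c; [rewrite !ger0_norm|rewrite subr0 mulrC].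
have [c /[!in_itv]/= /andP[tc c0] E] :=
  MVT_segment (ltW t0) (fun s _ => fd s) (cf _).
exists c; first by rewrite !ler0_norm ?lerN2// ltW.
by apply: oppr_inj; rewrite opprB E sub0r mulrN mulrC.
Qed.

(** * The second-derivative test at a global maximum of one variable *)

Section SecondDerivativeTest.
Variables (R : realType) (f f1 : R -> R) (f2 c : R).
Hypothesis fd : forall s, is_derive s (1 : R) f (f1 s).
Hypothesis f1d : is_derive c (1 : R) f1 f2.
Hypothesis fmax : forall s, f s <= f c.

Lemma is_derive_max_eq0 : f1 c = 0.
Proof.
have [|||s _|_ e] := @derive1_at_max R f (c - 1) (c + 1) c; rewrite ?in_itv /=.
- by rewrite lerD2l; lra.
- by move=> s _; case: (fd s).
- by apply/andP; split; lra.
- exact: fmax.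
- by rewrite -e; case: (fd c).
Qed.

(** Since [f1 c = 0], a positive [f2] would make [f1] positive just to the right of [c], and the
    mean value theorem would then give a value of [f] exceeding [f c]. *)
Lemma is_derive2_max_le0 : f2 <= 0.
Proof.
rewrite leNgt; apply/negP => f2_gt0.
case: f1d => d1 e1; have := d1; rewrite /derivable => /cvg_ex[l cl].
have el : l = f2 by rewrite -e1 /derive; apply/esym/cvg_lim.
rewrite el in cl.
have : \forall h \near (0:R)^', 0 < h^-1 *: ((f1 \o shift c) (h *: 1) - f1 c).
  exact: (cvgr_gt f2 cl).
move=> /nbhs_ballP[e /= e0 H].
have cf (A : set R) : {within A, continuous f}.
  apply: continuous_subspaceT => r.
  by apply/differentiable_continuous/derivable1_diffP; case: (fd r).
have lt_c : c < c + e / 2 by rewrite ltrDl divr_gt0.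
have [s /[!in_itv]/= /andP[cs se] E] := MVT lt_c (fun s _ => fd s) (cf _).
have := fmax (c + e / 2); rewrite -subr_le0 E leNgt => /negP; apply.
apply: mulr_gt0; last by rewrite subr_gt0.
have sc : 0 < s - c by rewrite subr_gt0.
have := H (s - c); rewrite /= is_derive_max_eq0 subr0 [(s - c) *: 1]mulr1.
rewrite subrK /GRing.scale /= pmulr_rgt0 ?invr_gt0//.
apply; last by rewrite gt_eqF.
rewrite /ball /= sub0r normrN gtr0_norm //.
by rewrite ltrBlDl (lt_trans se) // ltrD2l ltr_pdivrMr // ltr_pMr // ltr1n.
Qed.

End SecondDerivativeTest.

(** * Derivatives along the coordinate axes: mixed partials, continuity, maxima of periodic
    functions *)

Section AxisDerivatives.
Variable R : realType.
Implicit Types (F G : 'rV[R]_3 -> R) (x y : 'rV[R]_3) (i j : 'I_3).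

Local Notation e i := (delta_mx 0 i : 'rV[R]_3).

Lemma norm_rV_ge x i : `|x 0 i| <= `|x|.
Proof.
by rewrite [`|x|]mx_normrE; apply: (bigmax_sup (0, i)).
Qed.

Lemma norm_delta_le1 i : `|e i| <= 1.
Proof.
rewrite [`|e i|]mx_normrE; apply: bigmax_le => // -[k l] _ /=.
by rewrite mxE; case: (_ && _); rewrite ?normr1 ?normr0.
Qed.

Lemma is_derive_axis F x i t : (forall y, derivable F y (e i)) ->
  is_derive t (1 : R) (fun s => F (x + s *: e i))
    (euclid_partial i F (x + t *: e i)).
Proof. by move=> dF; apply: is_derive_line. Qed.

Lemma shift_quotient F x i y :
  (fun h : R => h^-1 *: (((fun z => F (z + x)) \o shift y) (h *: e i)
    - F (y + x))) =
  (fun h : R => h^-1 *: ((F \o shift (y + x)) (h *: e i) - F (y + x))).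
Proof. by apply/funext => h /=; rewrite addrA. Qed.

Lemma derivable_shift F x i y :
  derivable F (y + x) (e i) -> derivable (fun z => F (z + x)) y (e i).
Proof. by rewrite /derivable shift_quotient. Qed.

Lemma euclid_partial_shift F x i :
  euclid_partial i (fun z => F (z + x)) = fun y => euclid_partial i F (y + x).
Proof.
by apply/funext => y; rewrite /euclid_partial /derive shift_quotient.
Qed.

Lemma MVT_axis F x i t : (forall y, derivable F y (e i)) ->
  exists2 c, `|c| <= `|t| &
    F (x + t *: e i) - F x = t * euclid_partial i F (x + c *: e i).
Proof.
move=> dF; have [c ct E] := MVT_0 t (fun s => is_derive_axis x s dF).
by exists c => //; rewrite -E scale0r addr0.
Qed.

(** Two uses of the mean value theorem: along axis [i] for the increment [G] in direction [j], then
    along axis [j] for the [i]-th partial. *)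
Lemma MVT_square F x i j t :
  (forall y, derivable F y (e i)) ->
  (forall y, derivable (euclid_partial i F) y (e j)) ->
  exists c d, [/\ `|c| <= `|t|, `|d| <= `|t| &
    F (x + t *: e i + t *: e j) - F (x + t *: e i) - F (x + t *: e j) + F x =
    t ^+ 2 * euclid_partial j (euclid_partial i F) (x + c *: e i + d *: e j)].
Proof.
move=> dF ddF; pose G y := F (y + t *: e j) - F y.
have HG s : is_derive s (1 : R) (fun s => G (x + s *: e i))
    (euclid_partial i F (x + s *: e i + t *: e j)
     - euclid_partial i F (x + s *: e i)).
  have -> : (fun s => G (x + s *: e i)) =
    (fun s => F ((x + t *: e j) + s *: e i)) - (fun s => F (x + s *: e i)).
    by apply/funext => r; rewrite /G !fctE addrAC.
  apply: is_deriveB; last exact: is_derive_axis.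
  by rewrite addrAC; exact: is_derive_axis.
have [c ct E] := MVT_0 t HG.
have [d dt E'] := MVT_axis (x + c *: e i) t ddF.
exists c, d; split=> //; rewrite expr2 -mulrA -E' -E /G scale0r addr0.
by ring.
Qed.

(** Schwarz's theorem: the second difference over a square is symmetric in [i] and [j], so the two
    mixed partials take a common value at points arbitrarily close to [x], and continuity carries
    the equality to [x]. *)
Lemma euclid_partialC F i j :
  (forall y, derivable F y (e i)) -> (forall y, derivable F y (e j)) ->
  (forall y, derivable (euclid_partial i F) y (e j)) ->
  (forall y, derivable (euclid_partial j F) y (e i)) ->
  continuous (euclid_partial j (euclid_partial i F)) ->
  continuous (euclid_partial i (euclid_partial j F)) ->
  euclid_partial j (euclid_partial i F) = euclid_partial i (euclid_partial j F).
Proof.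
move=> dFi dFj dFij dFji cij cji; apply/funext => x; apply/eqP.
set P := euclid_partial j _ in cij *; set Q := euclid_partial i _ in cji *.
rewrite -subr_eq0 -normr_eq0 eq_le normr_ge0 andbT.
apply/ler_addgt0Pr => eps eps0; rewrite add0r.
have e2 : 0 < eps / 2 by rewrite divr_gt0.
have /nbhs_ballP[r1 /= r10 H1] : \forall y \near x, `|P x - P y| < eps / 2.
  by have /cvgrPdist_lt := cij x; apply.
have /nbhs_ballP[r2 /= r20 H2] : \forall y \near x, `|Q x - Q y| < eps / 2.
  by have /cvgrPdist_lt := cji x; apply.
(* Two axis moves of length at most [t] stay within r/2 of [x], hence inside both balls. *)
pose t := Num.min r1 r2 / 4.
have t0 : 0 < t by rewrite divr_gt0 // lt_min r10.
have near_x k l a b r : `|a| <= `|t| -> `|b| <= `|t| -> t <= r / 4 -> 0 < r ->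
    ball x r (x + a *: e k + b *: e l).
  rewrite (gtr0_norm t0) => at_ bt tr r0; rewrite -ball_normE /= -addrA opprD.
  rewrite addrA subrr add0r normrN (le_lt_trans (ler_normD _ _)) // !normrZ.
  have := ler_pM (normr_ge0 a) (normr_ge0 _) at_ (norm_delta_le1 k).
  have := ler_pM (normr_ge0 b) (normr_ge0 _) bt (norm_delta_le1 l).
  by rewrite !mulr1; lra.
have tr1 : t <= r1 / 4 by rewrite ler_pM2r // ge_min lexx.
have tr2 : t <= r2 / 4 by rewrite ler_pM2r // ge_min lexx orbT.
have [c [d [ct dt E1]]] := MVT_square x t dFi dFij.
have [c' [d' [ct' dt' E2]]] := MVT_square x t dFj dFji.
have E : P (x + c *: e i + d *: e j) = Q (x + c' *: e j + d' *: e i).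
  apply: (mulfI (_ : t ^+ 2 != 0)); first by rewrite expf_neq0 // gt_eqF.
  apply: etrans (esym E1) (etrans _ E2).
  by rewrite (addrAC x); ring.
have h1 := H1 _ (near_x i j _ _ r1 ct dt tr1 r10).
have h2 := H2 _ (near_x j i _ _ r2 ct' dt' tr2 r20).
rewrite distrC in h2; rewrite E in h1; clear - h1 h2; clearbody P Q.
have := ler_distD (Q (x + c' *: e j + d' *: e i)) (P x) (Q x).
lra.
Qed.

(** Moving from [x] to [y] along the three axes in turn, each move changes [F] by at most [K] times
    its length. This gives continuity of correlations, for which only axis derivatives are at
    hand. *)
Lemma axis_bounded_continuous F (K : R) :
  (forall i y, derivable F y (e i)) ->
  (forall i y, `|euclid_partial i F y| <= K) -> continuous F.
Proof.
move=> dF bF x.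
have K0 : 0 <= K by apply: le_trans (bF 0 x).
have lip y i t : `|F (y + t *: e i) - F y| <= K * `|t|.
  have [c _ ->] := MVT_axis y t (dF i).
  by rewrite normrM mulrC ler_wpM2r.
apply/(@cvgrPdist_le _ _ _ _ (nbhs_filter x)) => eps eps0.
apply/(@nbhs_ballP R 'rV[R]_3).
(* Three moves cost at most 3K times the radius; the added 1 keeps the denominator positive when [K]
   is 0. *)
exists (eps / (3 * K + 1)) => /=; first by rewrite divr_gt0 //; lra.
move=> y; rewrite -ball_normE /= distrC => xy.
have -> : y = x + (y - x) 0 ord0 *: e ord0 + (y - x) 0 1 *: e 1
               + (y - x) 0 2%:R *: e 2%:R.
  by apply/rowP => -[[|[|[|//]]] i3]; rewrite !mxE /= ?mulr1 ?mulr0 ?addr0;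
     rewrite -[LHS](subrKC (x 0 (Ordinal i3)));
     congr (_ + (y _ _ - x _ _)); apply/val_inj.
clear - K0 lip eps0 xy.
set z := y - x in xy *.
have b i : K * `|z 0 i| <= K * (eps / (3 * K + 1)).
  by apply: ler_wpM2l => //; apply: le_trans (ltW xy); exact: norm_rV_ge.
have bK : 3 * (K * (eps / (3 * K + 1))) <= eps.
  by rewrite !mulrA ler_pdivrMr; nra.
rewrite distrC.
have := lip x ord0 (z 0 ord0); have := b ord0.
set x1 := x + _; have := lip x1 1 (z 0 1); have := b 1.
set x2 := x1 + _; have := lip x2 2%:R (z 0 2%:R); have := b 2%:R.
set x3 := x2 + _.
have := ler_distD (F x1) (F x3) (F x); have := ler_distD (F x2) (F x3) (F x1).
move: bK; clearbody x3 x2 x1 z; clear; lra.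
Qed.

(** The maximum over the compact box [0, 2 pi]^3 is global, because every point has a lattice
    translate in the box. *)
Lemma periodic_max F : continuous F ->
  (forall x z, F (x + lattice_vec R z) = F x) -> exists p, forall x, F x <= F p.
Proof.
move=> cF perF.
pose box := [set v : 'rV[R]_3 | forall i, `[0, 2 * pi]%classic (v ord0 i)].
have cbox : compact box.
  apply: (@rV_compact R 3 (fun=> `[0, 2 * pi]%classic)) => i.
  exact: segment_compact.
have [||p _ H] := EVT_max_rV _ cbox (f := F).
- by exists 0 => i /=; rewrite mxE in_itv /= lexx mulr_ge0 // pi_ge0.
- exact: continuous_subspaceT.
exists p => x.
have pi20 : 0 < 2 * pi :> R by rewrite mulr_gt0 // pi_gt0.
(* Removing the integer part of each coordinate, measured in periods, brings [x] into the box. *)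
pose z i := - Num.floor (x 0 i / (2 * pi)).
rewrite -(perF x z); apply: H; rewrite inE => i /=.
rewrite in_itv /= !mxE /z intrN mulrN subr_ge0 lerBlDr.
apply/andP; split.
  by rewrite mulrC -ler_pdivlMr // ge_floor.
rewrite -[X in _ <= X + _]mulr1 -mulrDr mulrC -ler_pdivrMr //.
by rewrite addrC -intrD1 ltW // floorD1_gt.
Qed.

End AxisDerivatives.

End ClassicalCalculus.

(** * Smooth functions on the torus and their translates *)

Section TorusCalculus.
Local Open Scope classical_set_scope.
Local Open Scope quotient_scope.

Section SmoothFunctions.
Variable R : realType.
Implicit Types (f g : smooth_fun R) (x y : 'rV[R]_3) (i j : 'I_3) (p : torus R).

Local Notation e i := (delta_mx 0 i : 'rV[R]_3).

Lemma periodic_lift_repr (f : torus R -> R) p : f p = periodic_lift f (repr p).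
Proof. by rewrite /periodic_lift reprK. Qed.

Lemma periodic_lift_inj f g : periodic_lift f = periodic_lift g -> f = g.
Proof.
move=> E; apply/val_inj/funext => p /=.
by rewrite !periodic_lift_repr E.
Qed.

Lemma periodic_liftP (f : torus R -> R) x (z : 'I_3 -> int) :
  periodic_lift f (x + lattice_vec R z) = periodic_lift f x.
Proof.
rewrite /periodic_lift; congr f.
by apply/esym/(pi_torusP x (x + lattice_vec R z)); exists z.
Qed.

Lemma smooth_fun_derivable f x i : derivable (periodic_lift f) x (e i).
Proof. by have /asboolP/(_ [::])[_] := smooth_valP f; apply. Qed.

Lemma smooth_fun_continuous f : continuous (periodic_lift f).
Proof. by have /asboolP/(_ [::])[] := smooth_valP f. Qed.

Lemma lift_smooth_partial i f :
  periodic_lift (smooth_partial i f) = euclid_partial i (periodic_lift f).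
Proof. exact: lift_torus_partial. Qed.

Lemma smooth_partial_lin i (a : R) f g :
  smooth_partial i (a *: f + g) = a *: smooth_partial i f + smooth_partial i g.
Proof.
apply/val_inj/funext => p /=.
have /asboolP sf := smooth_valP f; have /asboolP sg := smooth_valP g.
by have /(congr1 (@^~ (repr p))) := foldr_partial_lin a [:: i] sf sg.
Qed.

Lemma smooth_partialC i j f :
  smooth_partial j (smooth_partial i f) = smooth_partial i (smooth_partial j f).
Proof.
apply: periodic_lift_inj.
rewrite [LHS]lift_smooth_partial [RHS]lift_smooth_partial.
rewrite (lift_smooth_partial i f) (lift_smooth_partial j f).
apply: euclid_partialC => [y|y|y|y||]; rewrite -?lift_smooth_partial;
  by [exact: smooth_fun_derivable|exact: smooth_fun_continuous].
Qed.

Lemma foldr_smooth_partialC i f (s : seq 'I_3) :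
  foldr (@smooth_partial R) (smooth_partial i f) s =
  smooth_partial i (foldr (@smooth_partial R) f s).
Proof. by elim: s => //= j s ->; rewrite smooth_partialC. Qed.

Lemma foldr_smooth_partial_lin (s : seq 'I_3) (a : R) f g :
  foldr (@smooth_partial R) (a *: f + g) s =
  a *: foldr (@smooth_partial R) f s + foldr (@smooth_partial R) g s.
Proof. by elim: s => //= j s ->; rewrite smooth_partial_lin. Qed.

Lemma foldr_smooth_partialB (s : seq 'I_3) f g :
  foldr (@smooth_partial R) (f - g) s =
  foldr (@smooth_partial R) f s - foldr (@smooth_partial R) g s.
Proof.
have := foldr_smooth_partial_lin s (-1) g f.
by rewrite !scaleN1r (addrC (- g)) [RHS]addrC.
Qed.

Lemma translate_subproof x f :
  (fun p => periodic_lift f (repr p + x)) \in @smooth R.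
Proof.
apply/asboolP => s.
set F := periodic_lift _.
have EF : F = fun y => periodic_lift f (y + x).
  apply/funext => y; rewrite /F {1}/periodic_lift.
  have /(pi_torusP y)[z ->] : 
    \pi_(torus R) y = \pi_(torus R) (repr (\pi_(torus R) y)).
    by rewrite reprK.
  by rewrite addrAC periodic_liftP.
have -> : foldr (@euclid_partial R) F s =
    fun y => foldr (@euclid_partial R) (periodic_lift f) s (y + x).
  by elim: s => [//|i s /= ->]; rewrite euclid_partial_shift.
have /asboolP/(_ s)[cf df] := smooth_valP f; split=> [y|y i].
  apply: (@continuous_comp _ _ _ (fun y => y + x)); last exact: cf.
  by apply: (@continuousD _ _ _ id (cst x));
    [exact: cvg_id|exact: cst_continuous].
by apply: derivable_shift; exact: df.
Qed.

(** The function f(_ + x). The chosen representative of the torus point is immaterial by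
    periodicity, as [lift_translate] shows. *)
Definition translate x f : smooth_fun R := SmoothFun (translate_subproof x f).

Lemma lift_translate x f :
  periodic_lift (translate x f) = fun y => periodic_lift f (y + x).
Proof.
apply/funext => y; rewrite {1}/periodic_lift /=.
have /(pi_torusP y)[z ->] : 
    \pi_(torus R) y = \pi_(torus R) (repr (\pi_(torus R) y)).
  by rewrite reprK.
by rewrite addrAC periodic_liftP.
Qed.

Lemma translate_lattice x (z : 'I_3 -> int) f :
  translate (x + lattice_vec R z) f = translate x f.
Proof.
apply: periodic_lift_inj; rewrite [LHS]lift_translate [RHS]lift_translate.
by apply/funext => y; rewrite addrA periodic_liftP.
Qed.

Lemma translate0 f : translate 0 f = f.
Proof.
apply: periodic_lift_inj; rewrite lift_translate.
by apply/funext => y; rewrite addr0.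
Qed.

Lemma smooth_partial_translate i x f :
  smooth_partial i (translate x f) = translate x (smooth_partial i f).
Proof.
apply: periodic_lift_inj; rewrite [RHS]lift_translate lift_smooth_partial.
by rewrite lift_translate euclid_partial_shift -lift_smooth_partial.
Qed.

Lemma foldr_smooth_partial_translate x f (s : seq 'I_3) :
  foldr (@smooth_partial R) (translate x f) s =
  translate x (foldr (@smooth_partial R) f s).
Proof. by elim: s => //= j s ->; rewrite smooth_partial_translate. Qed.

Lemma smooth_fun_bounded f : exists K, forall p, `|f p| <= K.
Proof.
have cf := @smooth_fun_continuous f.
have [x Hx] := periodic_max cf (periodic_liftP f).
have [||y Hy] := @periodic_max R (- periodic_lift f).
- by move=> y; apply: continuousN; apply: cf.
- by move=> y z; rewrite !fctE periodic_liftP.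
exists (`|periodic_lift f x| + `|periodic_lift f y|) => p.
rewrite periodic_lift_repr; have := Hx (repr p); have := Hy (repr p).
rewrite !fctE lerN2 => h1 h2.
have := ler_norm (periodic_lift f x); have := ler_norm (- periodic_lift f y).
have := normr_ge0 (periodic_lift f x); have := normr_ge0 (periodic_lift f y).
rewrite ler_norml normrN; lra.
Qed.

(** The C^N norms are finite. The induction peels off the innermost derivative, the last entry of
    [s], and applies the hypothesis to each [smooth_partial i f]. *)
Lemma smooth_fun_CN_bounded N f : exists K, forall (s : seq 'I_3) p,
  (size s <= N)%N -> `|foldr (@smooth_partial R) f s p| <= K.
Proof.
elim: N f => [|N IH] f.
  by have [K HK] := smooth_fun_bounded f; exists K => -[|//] p _.
have [K HK] := smooth_fun_bounded f.
have /choice[L HL] i := IH (smooth_partial i f).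
have L0 i : 0 <= L i by apply: le_trans (HL i [::] (\pi_(torus R) 0) _).
exists (K + \sum_i L i) => s; elim/last_ind: s => [|s i _] p.
  by move=> _; apply: le_trans (HK p) _; rewrite lerDl sumr_ge0.
rewrite size_rcons ltnS foldr_rcons => /(HL i s p) H; apply: le_trans H _.
rewrite (bigD1 i) //= addrCA lerDl addr_ge0 ?sumr_ge0 //.
exact: le_trans (HK p).
Qed.

End SmoothFunctions.

(** * Harmonic distributions *)

(** Dividing the quadratic remainder by the increment h leaves an error of at most K |h| in the
    difference quotient. *)
Lemma is_derive_quadratic (R : realType) (V : normedModType R) (F : V -> R)
    (x v : V) (d K : R) :
  (forall t, `|F (x + t *: v) - F x - t * d| <= K * t ^+ 2) ->
  is_derive x v F d.
Proof.
move=> H.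
have K0 : 0 <= K.
  by have := le_trans (normr_ge0 _) (H 1); rewrite expr1n mulr1.
have cd : h^-1 *: ((F \o shift x) (h *: v) - F x) @[h --> 0^'] --> d.
  apply/(@cvgrPdist_le _ _ _ _ (@dnbhs_filter _ (0 : R))) => eps eps0.
  apply/nbhs_ballP; exists (eps / (K + 1)) => /=.
    by rewrite divr_gt0 //; lra.
  move=> h; rewrite /ball /= sub0r normrN => hK h0.
  rewrite (addrC _ x) distrC.
  have -> : h^-1 *: (F (x + h *: v) - F x) - d =
      h^-1 * (F (x + h *: v) - F x - h * d).
    by rewrite /GRing.scale /=; field.
  rewrite normrM normfV ler_pdivrMl ?normr_gt0 //.
  apply: le_trans (H h) _; rewrite -(real_normK (num_real h)) expr2 mulrCA.
  rewrite ler_wpM2l //; apply: le_trans (ler_wpM2l K0 (ltW hK)) _.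
  by rewrite mulrA ler_pdivrMr; nra.
by split; [apply/cvg_ex; exists d|apply: cvg_lim].
Qed.

(** The left-hand side of the conclusion is half the second derivative at 0 of a^2 + eps f^2, which
    is maximal there. *)
Lemma max_sum_sqr_le0 (R : realType) (a a1 f f1 : R -> R) (a2 f2 eps : R) :
  (forall s, is_derive s (1 : R) a (a1 s)) ->
  (forall s, is_derive s (1 : R) f (f1 s)) ->
  is_derive (0 : R) (1 : R) a1 a2 -> is_derive (0 : R) (1 : R) f1 f2 ->
  (forall s, a s ^+ 2 + eps * f s ^+ 2 <= a 0 ^+ 2 + eps * f 0 ^+ 2) ->
  a1 0 ^+ 2 + a 0 * a2 + eps * (f1 0 ^+ 2 + f 0 * f2) <= 0.
Proof.
move=> da df da1 df1 H.
pose W := a * a + eps *: (f * f).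
pose W1 := 2 *: (a * a1) + (2 * eps) *: (f * f1).
have dW s : is_derive s (1 : R) W (W1 s).
  have dWs := is_deriveD (is_deriveM (da s) (da s))
    (is_deriveZ eps (is_deriveM (df s) (df s))).
  by apply: (is_derive_eq dWs); rewrite /W1 !fctE /GRing.scale /=; ring.
pose W2 := 2 * (a1 0 ^+ 2 + a 0 * a2 + eps * (f1 0 ^+ 2 + f 0 * f2)).
have dW1 : is_derive (0 : R) (1 : R) W1 W2.
  have dW1 := is_deriveD (is_deriveZ 2 (is_deriveM (da 0) da1))
    (is_deriveZ (2 * eps) (is_deriveM (df 0) df1)).
  by apply: (is_derive_eq dW1); rewrite /W2 /GRing.scale /=; ring.
suff : W2 <= 0 by rewrite /W2 pmulr_rle0.
by apply: (is_derive2_max_le0 dW dW1) => s; rewrite /W !fctE -!expr2.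
Qed.

(** * Correlation of a distribution with the translates of a test function *)

Section Distributions.
Variables (R : realType) (u : torus_distribution R).
Implicit Types (f g : smooth_fun R) (x y : 'rV[R]_3) (i j : 'I_3) (p : torus R).

Local Notation e i := (delta_mx 0 i : 'rV[R]_3).

Lemma distribution_lin (a : R) f g : u (a *: f + g) = a * u f + u g.
Proof. by have /asboolP[lu _] := torus_distributionP u; exact: lu. Qed.

Lemma distributionB f g : u (f - g) = u f - u g.
Proof.
have := distribution_lin (-1) g f.
by rewrite scaleN1r mulN1r (addrC (- g)) (addrC (- u g)).
Qed.

(** Continuity phrased with a real bound [K] on the derivatives, so that the estimates below stay in
    the reals. *)
Lemma distribution_bound : exists (C : R) (N : nat), 0 <= C /\
  forall f K, (forall (s : seq 'I_3) p, (size s <= N)%N ->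
    `|foldr (@smooth_partial R) f s p| <= K) -> `|u f| <= C * K.
Proof.
have /asboolP[_ [C [N [C0 H]]]] := torus_distributionP u.
exists C, N; split=> // f K fK; rewrite -lee_fin EFinM.
apply: le_trans (H f) _; apply: lee_wpmul2l; rewrite ?lee_fin //.
by apply: ge_ereal_sup => _ [s [p [sN ->]]]; rewrite lee_fin; exact: fK.
Qed.

Lemma translate_bounded f : exists K, forall x, `|u (translate x f)| <= K.
Proof.
have [C [N [C0 H]]] := distribution_bound.
have [K HK] := smooth_fun_CN_bounded N f.
exists (C * K) => x; apply: H => s p sN.
by rewrite foldr_smooth_partial_translate; exact: HK.
Qed.

(** Taylor's formula for translates, with a remainder of order t^2 in the C^N norm uniformly in [x];
    continuity of [u] transfers it to the pairing. *)
Lemma translate_quadratic f i : exists K, forall x t,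
  `|u (translate (x + t *: e i) f) - u (translate x f)
    - t * u (translate x (smooth_partial i f))| <= K * t ^+ 2.
Proof.
have [C [N [C0 H]]] := distribution_bound.
(* The remainder involves two derivatives beyond the [N] that the continuity of [u] controls. *)
have [L HL] := smooth_fun_CN_bounded N.+2 f.
exists (C * L) => x t.
have -> : u (translate (x + t *: e i) f) - u (translate x f)
    - t * u (translate x (smooth_partial i f)) =
    u (- t *: translate x (smooth_partial i f)
       + (translate (x + t *: e i) f - translate x f)).
  by rewrite distribution_lin distributionB mulNr addrC.
rewrite -mulrA; apply: H => s p sN.
rewrite foldr_smooth_partial_lin foldr_smooth_partialB.
(* Derivatives commute with translation and with each other, so the differentiated remainder is the
   same first-order remainder, now for [g]. *)
rewrite !foldr_smooth_partial_translate foldr_smooth_partialC.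
set g := foldr _ f s.
have -> : (- t *: translate x (smooth_partial i g) +
     (translate (x + t *: e i) g - translate x g)) p =
   periodic_lift g (repr p + x + t *: e i) - periodic_lift g (repr p + x)
   - t * periodic_lift (smooth_partial i g) (repr p + x).
  rewrite addrC; congr (_ + _); last exact: mulNr.
  by rewrite -(addrA (repr p)).
set z := repr p + x.
(* Two mean values turn the remainder into t c times a second derivative of [g], with |c| <= |t|. *)
have [c ct ->] := MVT_axis z t (@smooth_fun_derivable R g ^~ i).
rewrite -lift_smooth_partial -mulrBr.
have [d _ ->] :=
  MVT_axis z c (@smooth_fun_derivable R (smooth_partial i g) ^~ i).
rewrite -lift_smooth_partial !normrM mulrA mulrC -(ger0_norm (sqr_ge0 t)).
rewrite normrX expr2; apply: ler_pM; rewrite ?mulr_ge0 //.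
  exact: (HL [:: i, i & s]).
by rewrite ler_wpM2l.
Qed.

(** The function h of the overview: up to reflections, the convolution of [u] with [f]. *)
Definition correlation f x := u (translate x f).

Lemma is_derive_correlation f x i :
  is_derive x (e i) (correlation f) (correlation (smooth_partial i f) x).
Proof.
by have [K HK] := translate_quadratic f i; apply: (is_derive_quadratic (HK x)).
Qed.

Lemma derivable_correlation f x i : derivable (correlation f) x (e i).
Proof. by case: (is_derive_correlation f x i). Qed.

Lemma euclid_partial_correlation f i :
  euclid_partial i (correlation f) = correlation (smooth_partial i f).
Proof. by apply/funext => x; case: (is_derive_correlation f x i). Qed.

Lemma is_derive_correlation_axis f x i (t : R) :
  is_derive t (1 : R) (fun s => correlation f (x + s *: e i))
    (correlation (smooth_partial i f) (x + t *: e i)).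
Proof.
rewrite -euclid_partial_correlation.
by apply: is_derive_axis => y; exact: derivable_correlation.
Qed.

(** The partials of a correlation are again correlations, and these are bounded because translation
    preserves the C^N bounds. *)
Lemma correlation_continuous f : continuous (correlation f).
Proof.
have /choice[K HK] i := translate_bounded (smooth_partial i f).
have K0 i : 0 <= K i by apply: le_trans (HK i 0).
apply: (@axis_bounded_continuous _ _ (\sum_i K i)) => i y.
  exact: derivable_correlation.
rewrite euclid_partial_correlation; apply: le_trans (HK i y) _.
by rewrite (bigD1 i) //= lerDl sumr_ge0.
Qed.

Lemma correlation_lattice f x (z : 'I_3 -> int) :
  correlation f (x + lattice_vec R z) = correlation f x.
Proof. by rewrite /correlation translate_lattice. Qed.

Hypothesis u_harmonic :
  forall f, \sum_i u (smooth_partial i (smooth_partial i f)) = 0.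

Lemma correlation_harmonic f x :
  \sum_i correlation (smooth_partial i (smooth_partial i f)) x = 0.
Proof.
apply: etrans (u_harmonic (translate x f)); apply: eq_bigr => i _.
by rewrite !smooth_partial_translate.
Qed.

(* [q] maximises (d_i h)^2 + eps * h^2, where h is the correlation of [f]. *)
Lemma correlation_bernstein f i (eps : R) : 0 < eps ->
  exists q, forall x, correlation (smooth_partial i f) x ^+ 2
    <= eps * correlation f q ^+ 2.
Proof.
move=> eps0; set a := smooth_partial i f.
pose w x := correlation a x ^+ 2 + eps * correlation f x ^+ 2.
have cw : continuous w.
  move=> x; rewrite /w.
  have ca := @correlation_continuous a x.
  have cf := @correlation_continuous f x.
  by apply: (cvgD (cvgM ca ca) (cvgM (cvg_cst eps) (cvgM cf cf))).
have [|q wq] := periodic_max cw.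
  by move=> x z; rewrite /w !correlation_lattice.
have w2 j : correlation (smooth_partial j a) q ^+ 2
    + correlation a q * correlation (smooth_partial j (smooth_partial j a)) q
    + eps * (correlation (smooth_partial j f) q ^+ 2
    + correlation f q * correlation (smooth_partial j (smooth_partial j f)) q)
    <= 0.
  pose A g s := correlation g (q + s *: e j).
  have dA g s : is_derive s (1 : R) (A g) (A (smooth_partial j g) s).
    exact: is_derive_correlation_axis.
  have A0 g : A g 0 = correlation g q by rewrite /A scale0r addr0.
  rewrite -!A0; apply: max_sum_sqr_le0 => // s.
  by rewrite !A0; exact: wq.
have aq0 : correlation a q = 0.
  have : \sum_j (correlation (smooth_partial j a) q ^+ 2
      + eps * correlation (smooth_partial j f) q ^+ 2) <= 0.
    (* Summed over [j], the terms with repeated derivatives vanish, since the correlations of both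
       [a] and [f] are harmonic. *)
    have -> : \sum_j (correlation (smooth_partial j a) q ^+ 2
      + eps * correlation (smooth_partial j f) q ^+ 2) =
      \sum_j (correlation (smooth_partial j a) q ^+ 2
      + correlation a q * correlation (smooth_partial j (smooth_partial j a)) q
      + eps * (correlation (smooth_partial j f) q ^+ 2
      + correlation f q
        * correlation (smooth_partial j (smooth_partial j f)) q)).
      under [RHS]eq_bigr => j _ do rewrite mulrDr addrACA.
      rewrite [RHS]big_split /= [X in _ = _ + X]big_split /= -!mulr_sumr.
      by rewrite !correlation_harmonic !mulr0 !addr0.
    by apply: sumr_le0 => j _; exact: w2.
  have ge0 j : 0 <= correlation (smooth_partial j a) q ^+ 2
      + eps * correlation (smooth_partial j f) q ^+ 2.
    exact: addr_ge0 (sqr_ge0 _) (mulr_ge0 (ltW eps0) (sqr_ge0 _)).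
  (* In the term [j = i] the summand weighted by [eps] is the square of [correlation a q] itself, as
     [a] is the [i]-th partial of [f]. *)
  rewrite (bigD1 i) //=; set S := \sum_(j | _) _ => H.
  have S0 : 0 <= S by apply: sumr_ge0.
  have s0 := sqr_ge0 (correlation (smooth_partial i a) q).
  apply/eqP; rewrite -sqrf_eq0 eq_le sqr_ge0 andbT.
  rewrite -(pmulr_rle0 _ eps0) -/a.
  apply: le_trans H; rewrite -addrA addrC -addrA lerDl addr_ge0 //.
exists q => x; apply: le_trans (_ : w x <= _).
  by rewrite lerDl (mulr_ge0 (ltW eps0) (sqr_ge0 _)).
by apply: le_trans (wq x) _; rewrite /w aq0 expr0n /= add0r.
Qed.

Lemma harmonic_partial_eq0 i f : u (smooth_partial i f) = 0.
Proof.
have [K HK] := translate_bounded f.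
have K0 : 0 <= K by apply: le_trans (HK 0).
(* This reads the goal as a correlation at 0, where the estimate of [correlation_bernstein]
   applies. *)
rewrite -(translate0 (smooth_partial i f)).
apply/eqP; rewrite -sqrf_eq0 eq_le sqr_ge0 andbT.
apply/ler_addgt0Pr => eps eps0; rewrite add0r.
(* With this weight the bound becomes eps K^2 / (K^2 + 1), which is at most [eps]. *)
have d0 : 0 < eps / (K ^+ 2 + 1) by rewrite divr_gt0 // ltr_wpDl ?sqr_ge0.
have [q Hq] := correlation_bernstein f i d0.
apply: le_trans (Hq 0) _; rewrite mulrAC ler_pdivrMr ?ltr_wpDl ?sqr_ge0 //.
apply: ler_wpM2l; first exact: ltW.
rewrite -(real_normK (num_real (correlation f q))).
apply: (@le_trans _ _ (K ^+ 2)); last by rewrite lerDl.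
by rewrite lerXn2r ?nnegrE //; exact: HK.
Qed.

End Distributions.

End TorusCalculus.

(** * Coefficients of forms *)

Section BooleanTriples.

(* [a], [b], [c] tell whether 0, 1, 2 belong to the set. *)
Definition bset (a b c : bool) : {set 'I_3} :=
  [set i : 'I_3 | nth false [:: a; b; c] i].

Lemma bset_eta (J : {set 'I_3}) : J = bset (0 \in J) (1 \in J) (2%:R \in J).
Proof.
apply/setP => -[[|[|[|//]]] i3]; rewrite inE /=; congr (_ \in J); exact/val_inj.
Qed.

Lemma setC_bset a b c : ~: bset a b c = bset (~~ a) (~~ b) (~~ c).
Proof. by apply/setP => -[[|[|[|//]]] i3]; rewrite !inE. Qed.

Lemma bset_rem0 a b c : bset a b c :\ 0 = bset false b c.
Proof. by apply/setP => -[[|[|[|//]]] i3]; rewrite !inE. Qed.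

Lemma bset_rem1 a b c : bset a b c :\ 1 = bset a false c.
Proof. by apply/setP => -[[|[|[|//]]] i3]; rewrite !inE. Qed.

Lemma bset_rem2 a b c : bset a b c :\ 2%:R = bset a b false.
Proof. by apply/setP => -[[|[|[|//]]] i3]; rewrite !inE. Qed.

Lemma bset_sing (i : 'I_3) : [set i] = bset (i == 0) (i == 1) (i == 2%:R).
Proof. by rewrite [LHS]bset_eta !inE !(eq_sym i). Qed.

Lemma sum_bset (V : nmodType) a b c (F : 'I_3 -> V) :
  \sum_(i in bset a b c) F i =
  (if a then F 0 else 0) + (if b then F 1 else 0) + (if c then F 2%:R else 0).
Proof.
rewrite big_mkcond !big_ord_recl big_ord0. rewrite /= addr0 addrA !inE /=.
by congr (_ + (if b then F _ else _) + (if c then F _ else _)); apply/val_inj.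
Qed.

Lemma card_bset a b c : #|bset a b c| = (a + b + c)%N.
Proof. by rewrite -sum1_card sum_bset; case: a b c => [] [] []. Qed.

(** The three summands of the exponent are the possible inversions (1,0), (2,0) and (2,1). *)
Lemma wedge_sign_bset (R : realType) a b c a' b' c' :
  wedge_sign R (bset a b c) (bset a' b' c') =
  (-1) ^+ (b && a' + (c && a') + (c && b')).
Proof.
rewrite /wedge_sign; congr (_ ^+ _).
rewrite -sum1dep_card (eq_bigl (fun ij : 'I_3 * 'I_3 =>
  (ij.1 \in bset a b c) && ((ij.2 \in bset a' b' c') && (ij.2 < ij.1)%N)));
  last by move=> ij; rewrite !inE andbA.
rewrite -(pair_big_dep (mem (bset a b c))
  (fun i j => (j \in bset a' b' c') && (j < i)%N) (fun _ _ => 1%N)) /=.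
rewrite sum_bset.
rewrite 3!(big_mkcond (fun j => _ && _)) !big_ord_recl !big_ord0 /= !inE /=.
by case: a b c a' b' c' => [] [] [] [] [] [].
Qed.

Lemma sum_set3 (V : nmodType) (P : pred {set 'I_3}) (F : {set 'I_3} -> V) :
  \sum_(I | P I) F I = \sum_(a : bool) \sum_(b : bool) \sum_(c : bool)
    if P (bset a b c) then F (bset a b c) else 0.
Proof.
rewrite big_mkcond !pair_bigA /=.
rewrite (reindex (fun t : (bool * bool) * bool => bset t.1.1 t.1.2 t.2)) //=.
exists (fun J : {set 'I_3} => ((0 \in J, 1 \in J), 2%:R \in J)) =>
  [[[a b] c]|J] _.
  by rewrite /= !inE.
by rewrite /= -bset_eta.
Qed.

End BooleanTriples.

(** * Exterior derivative, Hodge star and co-derivative in coefficients *)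

Section Coefficients.
Variables (R : realType) (V : lmodType R) (partial : 'I_3 -> V -> V).

(** [form_coef] is 0 by default on sets of the wrong size; this is the source of the cardinality
    tests in the formulas below. *)
Lemma form_coef_ffun p (E : {set 'I_3} -> V) (J : {set 'I_3}) :
  form_coef ([ffun J : multi_index p => E (val J)] : alt_form V p) J =
  if #|J| == p then E J else 0.
Proof.
rewrite /form_coef; case: insubP => [K -> <-|/negbTE -> //].
by rewrite /= ffunE.
Qed.

Lemma form_coef_ext_d p (w : alt_form V p) a b c :
  form_coef (ext_d partial w) (bset a b c) =
  if (a + b + c == p.+1)%N then
    (if a then partial 0 (form_coef w (bset false b c)) else 0) +
    (if b then (-1) ^+ a *: partial 1 (form_coef w (bset a false c)) else 0) +
    (if c then (-1) ^+ (a + b) *: partial 2%:R (form_coef w (bset a b false))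
     else 0)
  else 0.
Proof.
rewrite /ext_d (form_coef_ffun _ (fun J => \sum_(i in J)
  wedge_sign R [set i] (J :\ i) *:
   partial i (form_coef w (J :\ i)))) card_bset sum_bset.
rewrite bset_rem0 bset_rem1 bset_rem2 !bset_sing !wedge_sign_bset /=.
by case: a b c => [] [] []; rewrite ?expr0 ?scale1r.
Qed.

Lemma form_coef_hodge_star p (w : alt_form V p) a b c :
  form_coef (hodge_star w) (bset a b c) =
  if (a + b + c == 3 - p)%N then
    wedge_sign R (bset (~~ a) (~~ b) (~~ c)) (bset a b c) *:
      form_coef w (bset (~~ a) (~~ b) (~~ c))
  else 0.
Proof.
rewrite /hodge_star (form_coef_ffun _
  (fun J => wedge_sign R (~: J) J *: form_coef w (~: J))).
by rewrite card_bset setC_bset.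
Qed.

Lemma form_coef_coderivative p (w : alt_form V p.+1) a b c :
  form_coef (coderivative partial w) (bset a b c) =
  if (a + b + c == p)%N then
    (-1) ^+ p.+1 *: form_coef (hodge_star (ext_d partial (hodge_star w)))
      (bset a b c)
  else 0.
Proof.
rewrite /coderivative (form_coef_ffun _ (fun J => (-1) ^+ p.+1 *:
  form_coef (hodge_star (ext_d partial (hodge_star w))) J)).
by rewrite card_bset.
Qed.

Lemma form_coefD p (w w' : alt_form V p) J :
  form_coef (w + w') J = form_coef w J + form_coef w' J.
Proof.
by rewrite /form_coef; case: insubP => [K _ _|_]; rewrite /= ?ffunE ?addr0.
Qed.

Lemma form_coefZ (a : R) p (w : alt_form V p) J :
  form_coef (a *: w) J = a *: form_coef w J.
Proof.
by rewrite /form_coef; case: insubP => [K _ _|_]; rewrite /= ?ffunE ?scaler0.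
Qed.

Lemma form_coef0 p J : form_coef (0 : alt_form V p) J = 0.
Proof. by rewrite /form_coef; case: insubP => [K _ _|_]; rewrite /= ?ffunE. Qed.

Lemma form_coef_scalar (v : V) a b c :
  form_coef (scalar_form v) (bset a b c) = if (a + b + c == 0)%N then v else 0.
Proof. by rewrite /scalar_form (form_coef_ffun _ (fun=> v)) card_bset. Qed.

End Coefficients.

(** * Distribution-valued forms evaluated on test functions *)

Section DistributionalCoefficients.
Variable R : realType.
Implicit Types (u v : torus_distribution R) (f g : smooth_fun R).

Lemma distribution_addE u v f : (u + v) f = u f + v f.
Proof. by []. Qed.

Lemma distribution_scaleE (a : R) u f : (a *: u) f = a * u f.
Proof. by []. Qed.

Lemma distribution_zeroE f : (0 : torus_distribution R) f = 0.
Proof. by []. Qed.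

Lemma dist_partialE i u f : dist_partial i u f = - u (smooth_partial i f).
Proof. by []. Qed.

Definition coef p (w : dform R p) (a b c : bool) f : R :=
  form_coef w (bset a b c) f.

(** The overall minus sign comes from the distributional derivative. Membership enters as a
    numerical factor, which keeps the right-hand side a ring expression. *)
Lemma coef_d p (w : dform R p) a b c f :
  coef (dist_d w) a b c f =
  if (a + b + c == p.+1)%N then
    - (a%:R * coef w false b c (smooth_partial 0 f)
      + b%:R * (-1) ^+ a * coef w a false c (smooth_partial 1 f)
      + c%:R * (-1) ^+ (a + b) * coef w a b false (smooth_partial 2%:R f))
  else 0.
Proof.
rewrite /coef /dist_d form_coef_ext_d; case: ifP => // _.
rewrite !distribution_addE; case: a b c => [] [] [];
rewrite ?distribution_scaleE ?dist_partialE ?distribution_zeroE /=; ring.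
Qed.

Lemma coef_star p (w : dform R p) a b c f :
  coef (hodge_star w) a b c f =
  if (a + b + c == 3 - p)%N then
    (-1) ^+ (~~ b && a + (~~ c && a) + (~~ c && b))
      * coef w (~~ a) (~~ b) (~~ c) f
  else 0.
Proof.
rewrite /coef form_coef_hodge_star; case: ifP => // _.
by rewrite distribution_scaleE wedge_sign_bset.
Qed.

Lemma coef_coderivative p (w : dform R p.+1) a b c f :
  coef (dist_coderivative w) a b c f =
  if (a + b + c == p)%N then
    (-1) ^+ p.+1 * coef (hodge_star (dist_d (hodge_star w))) a b c f
  else 0.
Proof.
rewrite /coef /dist_coderivative form_coef_coderivative; case: ifP => // _.
Qed.

Lemma coefD p (w w' : dform R p) a b c f :
  coef (w + w') a b c f = coef w a b c f + coef w' a b c f.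
Proof. by rewrite /coef form_coefD. Qed.

Lemma coefZ p (w : dform R p) (r : R) a b c f :
  coef (r *: w) a b c f = r * coef w a b c f.
Proof. by rewrite /coef form_coefZ. Qed.

Lemma coef_sum p n (w : 'I_n -> dform R p) a b c f :
  coef (\sum_i w i) a b c f = \sum_i coef (w i) a b c f.
Proof.
apply: (big_morph (fun w => coef w a b c f)) => [w1 w2|]; first exact: coefD.
by rewrite /coef form_coef0.
Qed.

Lemma coef_dirac q f : coef (dirac_form q) true true true f = f q.
Proof.
by rewrite /coef /dirac_form /volume_form (form_coef_ffun _
  (fun=> dirac_dist q)) card_bset.
Qed.

(** On the flat torus the Hodge Laplacian acts coefficientwise: the mixed second derivatives from
    the two summands cancel, and only the pure ones remain. *)
Lemma coef_laplacian2 (w : dform R 2) (a b c : bool) f : (a + b + c == 2)%N ->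
  coef (laplacian (@dist_partial R) w) a b c f =
  - \sum_i coef w a b c (smooth_partial i (smooth_partial i f)).
Proof.
move=> abc.
have -> : laplacian (@dist_partial R) w =
  dist_d (dist_coderivative w) + dist_coderivative (dist_d w) by [].
rewrite [LHS]coefD 3!big_ord_recl big_ord0 /=.
rewrite (_ : lift ord0 ord0 = 1); last exact/val_inj.
rewrite (_ : lift ord0 (lift ord0 ord0) = 2%:R); last exact/val_inj.
rewrite (_ : ord0 = 0); last exact/val_inj.
(* In each of the three components, once [DC] puts mixed partials in a common order, the claim is a
   linear identity between values of the coefficients. *)
by case: a b c abc => [] [] [] // _;
  rewrite coef_d !coef_coderivative /= ?mul0r ?mul1r !coef_star /= !coef_d /=;
  rewrite ?mul0r ?mul1r !coef_star /= ?coef_d /=;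
  move: (@smooth_partialC R); generalize (@smooth_partial R) => D DC;
  rewrite ?(DC 0 1) ?(DC 0 2%:R) ?(DC 1 2%:R); ring.
Qed.

Lemma harmonic_form2_partial (w : dform R 2) (a b c : bool) i f :
  (a + b + c == 2)%N -> harmonic_form w ->
  coef w a b c (smooth_partial i f) = 0.
Proof.
move=> abc hw; apply: harmonic_partial_eq0 => {}f.
apply: oppr_inj; rewrite oppr0 -(coef_laplacian2 _ f abc) hw.
by rewrite /coef form_coef0.
Qed.

Lemma dist_d_harmonic_form2 (w : dform R 2) f :
  harmonic_form w -> coef (dist_d w) true true true f = 0.
Proof.
move=> hw; rewrite coef_d /= !(harmonic_form2_partial _ _ _ hw) //.
by rewrite !mulr0 !addr0 oppr0.
Qed.

(** Each coefficient of [w] occurs with two mixed partials of opposite signs, which cancel by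
    commutation. *)
Lemma dist_dd1 (w : dform R 1) f :
  coef (dist_d (dist_d w)) true true true f = 0.
Proof.
rewrite coef_d /= !coef_d /=.
move: (@smooth_partialC R); generalize (@smooth_partial R) => D DC.
rewrite (DC 0 1) (DC 0 2%:R) (DC 1 2%:R); ring.
Qed.

Lemma dist_dD p (w w' : dform R p) : dist_d (w + w') = dist_d w + dist_d w'.
Proof.
apply/ffunP => J; rewrite !ffunE -big_split /=; apply: eq_bigr => i _.
rewrite form_coefD -scalerDr; congr (_ *: _).
by apply/val_inj/funext => f; exact: opprD.
Qed.

Lemma integral_wedge0 (W : smooth_fun R) (T : dform R 3) :
  integral_wedge (p := 0) (scalar_form W) T = coef T true true true W.
Proof.
rewrite /integral_wedge sum_set3 !big_bool !card_bset /= !add0r ?addr0.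
by rewrite setC_bset wedge_sign_bset form_coef_scalar /= mul1r.
Qed.

(** The middle sign is that of the permutation bringing dk_1, dk_0, dk_2 into increasing order. *)
Lemma integral_wedge1 (b : sform R 1) (T : dform R 2) :
  integral_wedge b T =
    coef T false true true (form_coef b (bset true false false))
    - coef T true false true (form_coef b (bset false true false))
    + coef T true true false (form_coef b (bset false false true)).
Proof.
rewrite /integral_wedge sum_set3 !big_bool !card_bset /= !add0r ?addr0.
by rewrite !setC_bset !wedge_sign_bset /= /coef; ring.
Qed.

(** The sign is the one in the definition of the distributional derivative; the signs of [ext_d] on
    2-forms match those of the wedge of a 1-form with a 2-form. *)
Lemma integral_by_parts (W : smooth_fun R) (T : dform R 2) :
  integral_wedge (p := 0) (scalar_form W) (dist_d T) =
  - integral_wedge (smooth_d (scalar_form W)) T.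
Proof.
rewrite integral_wedge0 integral_wedge1 coef_d /smooth_d !form_coef_ext_d /=.
rewrite !form_coef_scalar /= !add0r !addr0 expr0 !scale1r; ring.
Qed.

End DistributionalCoefficients.

(** * The anomaly coupling: its reduction to the co-exact part and its value at the nodes *)

Theorem mainTheorem3 (R : realType)
    (N : nat) (k : 'I_N -> torus R) (chi : 'I_N -> R)
    (Omega : dform R 2)
    (gamma : dform R 2) (calA : dform R 1) (calB : dform R 3)
    (W : smooth_fun R) :
  (forall n, chi n = 1 \/ chi n = -1) ->
  dist_d Omega = (2 * pi) *: \sum_(n < N) chi n *: dirac_form (k n) ->
  hodge_decomposition Omega gamma calA calB ->
  [/\ integral_wedge (scalar_form W) (dist_d gamma) = 0,
      integral_wedge (scalar_form W) (dist_d (dist_d calA)) = 0,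
      anomaly_coupling W Omega =
        integral_wedge (scalar_form W) (dist_d (dist_coderivative calB)),
      integral_wedge (scalar_form W) (dist_d (dist_coderivative calB)) =
        - integral_wedge (smooth_d (scalar_form W)) (dist_coderivative calB) &
      anomaly_coupling W Omega = \sum_(n < N) (2 * pi * chi n) * W (k n)].
Proof.
move=> _ dOmega [harm_gamma defOmega].
have dgamma : integral_wedge (scalar_form W) (dist_d gamma) = 0.
  by rewrite integral_wedge0 dist_d_harmonic_form2.
have ddA : integral_wedge (scalar_form W) (dist_d (dist_d calA)) = 0.
  by rewrite integral_wedge0 dist_dd1.
split=> //; [|exact: integral_by_parts|].
  (* By linearity the coupling splits over the Hodge summands, the first two of which contribute
     0. *)
  rewrite /anomaly_coupling defOmega !dist_dD !integral_wedge0 !coefD.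
  by rewrite -!integral_wedge0 dgamma ddA !add0r.
(* Pairing the prescribed sum of Dirac forms with [W] evaluates [W] at each node. *)
rewrite /anomaly_coupling dOmega integral_wedge0 coefZ coef_sum mulr_sumr.
by apply: eq_bigr => n _; rewrite coefZ coef_dirac mulrA.
Qed.
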